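(* Let $L|K$ be an extension of fields, $\nu$ a $K$-module valuation on $L$, and $\chi\in L$ algebraic or transcendental over $K$. Let $d\in\mathbb{N}\cup\{\infty\}$ be such that $0<d$ and, if $\chi$ is algebraic over $K$, $d<[K[\chi]:K]$. The extension $(K_d[\chi]|K,\nu)$ is vs defectless if, and only if, for every integer $n$ with $1\le n\le d$, $\nu(\chi^n-K_{n-1}[\chi])$ has a maximal element. Assume that $\chi$ is transcendental over $K$, and that $\nu$ is multiplicative on $K(\chi)$. Then $(K(\chi)|K,\nu)$ is vs defectless if, and only if, for every $n\in\mathbb{N}\setminus\{0\}$, $\nu(\chi^n-K_{n-1}[\chi])$ has a maximal element.
   Context: A $K$-module valuation on $L$ is a map $\nu:L\to\Gamma\cup\{\infty\}$, $\Gamma$ a linearly ordered abelian group, such that $\nu(y)=\infty\Leftrightarrow y=0$, $\nu(y_1+y_2)\ge\min(\nu(y_1),\nu(y_2))$ and $\nu(xy)=\nu(x)+\nu(y)$ for all $x\in K$, $y,y_1,y_2\in L$. It is multiplicative if it is a field valuation in the usual sense. It is assumed that $\nu K$ has finite rank (finitely many convex subgroups). For $l\in L$ and a $K$-submodule $M$ of $L$, $\nu(l-M):=\{\nu(l-x):x\in M\}\setminus\{\infty\}$. $K_m[\chi]$ is the $K$-module of polynomials in $\chi$ over $K$ of degree at most $m$; $K_0[\chi]=K$ and, in the transcendental case, $K_\infty[\chi]=K[\chi]$. A sequence $(l_1,\dots,l_n)$ of (nonzero) elements of $L$ is separated over $K$ if $\nu(x_1l_1+\cdots+x_nl_n)=\min_{1\le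 i\le n}\nu(x_il_i)$ for all $x_1,\dots,x_n\in K$. For a $K$-submodule $N$ of $L$ (with $K\subseteq N$), $(N|K,\nu)$ is vs defectless if every finitely generated $K$-submodule of $N$ admits a basis which is separated over $K$. *)

(* Defs.v *)
From mathcomp Require Import all_boot all_order all_algebra.
From mathcomp Require Import boolp classical_sets cardinality.

Set Implicit Arguments.
Unset Strict Implicit.
Unset Printing Implicit Defensive.

Import Order.TTheory GRing.Theory Num.Theory.
Local Open Scope classical_set_scope.
Local Open Scope ring_scope.

(* [porderZmodType] carries an order and an addition but does not relate them. *)
Definition linearly_ordered_group (G : porderZmodType) : Prop :=
  (forall x y : G, (x <= y) || (y <= x)) /\
  (forall x y z : G, x <= y -> z + x <= z + y).

(* [option G] stands for the disjoint union of G and {oo}, with [None] for oo. *)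
Section ExtendedGroup.
Variable G : porderZmodType.
Implicit Types u v : option G.

Definition vadd u v : option G :=
  if (u, v) is (Some a, Some b) then Some (a + b) else None.

Definition vle u v : bool :=
  match u, v with
  | _, None => true
  | None, Some _ => false
  | Some a, Some b => a <= b
  end.

Definition vmin u v : option G := if vle u v then u else v.

Definition has_maximal (S : set G) : Prop :=
  exists2 g, S g & forall h, S h -> ~~ (g < h).

End ExtendedGroup.

(* An extension of fields L|K is given by an embedding iota : K -> L; the
   scalar multiplication of L as a K-module is iota x * y. *)
Section FieldExtension.
Variables (K L : fieldType) (iota : {rmorphism K -> L}).

Definition span n (l : 'I_n -> L) : set L :=
  [set \sum_(i < n) iota (x i) * l i | x in [set: 'I_n -> K]].

Definition lin_indep n (l : 'I_n -> L) : Prop :=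
  forall x : 'I_n -> K,
    \sum_(i < n) iota (x i) * l i = 0 -> forall i, x i = 0.

Definition is_basis (M : set L) n (l : 'I_n -> L) : Prop :=
  lin_indep l /\ M = span l.

Definition has_dim (M : set L) (n : nat) : Prop :=
  exists l : 'I_n -> L, is_basis M l.

Definition finitely_generated (M : set L) : Prop :=
  exists n (l : 'I_n -> L), M = span l.

(* K_d[chi], with [None] for d = oo; note that size p = deg p + 1. *)
Definition polys_in (chi : L) (d : option nat) : set L :=
  [set (map_poly iota p).[chi] |
    p in [set p : {poly K} | if d is Some m then (size p <= m.+1)%N else true]].

Definition fractions_in (chi : L) : set L :=
  [set y | exists2 p : {poly K} * {poly K},
     (map_poly iota p.2).[chi] != 0 &
     y = (map_poly iota p.1).[chi] / (map_poly iota p.2).[chi]].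

Variables (G : porderZmodType) (nu : L -> option G).

Record module_valuation : Prop := {
  mval_eq_oo : forall y, nu y = None <-> y = 0;
  mval_add : forall y1 y2, vle (vmin (nu y1) (nu y2)) (nu (y1 + y2));
  mval_scale : forall (x : K) (y : L),
    nu (iota x * y) = vadd (nu (iota x)) (nu y)
}.

Definition multiplicative_on (F : set L) : Prop :=
  forall y z, F y -> F z -> nu (y * z) = vadd (nu y) (nu z).

Definition value_group : set G :=
  [set g | exists x : K, nu (iota x) = Some g].

Definition convex_subgroup (V H : set G) : Prop :=
  [/\ H `<=` V, H 0, forall g h, H g -> H h -> H (g - h)
    & forall a b g, H a -> H b -> V g -> a <= g <= b -> H g].

Definition finite_rank (V : set G) : Prop :=
  finite_set [set H : set G | convex_subgroup V H].

(* The value oo, taken when l is in M, is discarded. *)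
Definition dist_values (l : L) (M : set L) : set G :=
  [set g | exists2 x, M x & nu (l - x) = Some g].

Definition separated n (l : 'I_n -> L) : Prop :=
  (forall i, l i != 0) /\
  forall x : 'I_n -> K,
    nu (\sum_(i < n) iota (x i) * l i)
    = \big[@vmin G/None]_(i < n) nu (iota (x i) * l i).

Definition vs_defectless (N : set L) : Prop :=
  forall M : set L, M `<=` N -> finitely_generated M ->
  exists n (l : 'I_n -> L), is_basis M l /\ separated l.

End FieldExtension.

(* Main.v *)
(* The key point is that a subspace of a finite-dimensional space with separated
   basis (l_i) again has one.  If the subspace is proper, a nonzero linear form f
   vanishes on it.  Choosing i such that nu (l_i / f(l_i)) is maximal, the vectors
   l_j - (f(l_j) / f(l_i)) l_i, j <> i, are a separated basis of the kernel of f,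
   and one concludes by induction on the dimension.  The same choice of i shows
   that l_i / f(l_i) has maximal value on the affine hyperplane f = 1; applied to
   K_n[chi] and the coefficient of chi^n this gives the maximal elements.
   Conversely, elements of maximal value in chi^i - K_{i-1}[chi] for i <= n,
   together with 1, form a separated basis of K_n[chi].  A finitely generated
   submodule of K(chi) is moved into K[chi] by a common denominator. *)

Require Import Defs.
From mathcomp Require Import all_boot all_order all_algebra.
From mathcomp Require Import boolp classical_sets cardinality.

Set Implicit Arguments.
Unset Strict Implicit.
Unset Printing Implicit Defensive.

Local Open Scope classical_set_scope.
Local Open Scope ring_scope.

Import Order.TTheory GRing.Theory.

Local Notation span := Defs.span.

(** * The ordered group with infinity adjoined *)

Section ExtendedOrder.
Variables (G : porderZmodType) (G_lin : linearly_ordered_group G).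
Implicit Types u v w : option G.

Lemma vle_refl u : vle u u.
Proof. by case: u => //= a; rewrite lexx. Qed.

Lemma vle_trans v u w : vle u v -> vle v w -> vle u w.
Proof. by case: u v w => [a|] [b|] [c|] //=; exact: le_trans. Qed.

Lemma vle_total u v : vle u v || vle v u.
Proof. by case: u v => [a|] [b|] //=; exact: G_lin.1. Qed.

Lemma vle_vadd u v w : vle u v -> vle (vadd w u) (vadd w v).
Proof. by case: u v w => [a|] [b|] [c|] //=; exact: G_lin.2. Qed.

Lemma vaddC u v : vadd u v = vadd v u.
Proof. by case: u v => [a|] [b|] //=; rewrite /vadd addrC. Qed.

Lemma vadd0 u : vadd (Some 0) u = u.
Proof. by case: u => //= a; rewrite /vadd add0r. Qed.

Lemma vle_vmin w u v : vle w (vmin u v) = vle w u && vle w v.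
Proof.
rewrite /vmin; case: ifP => [le_uv|/negbT nle_uv].
  by apply/idP/andP => [le_wu|[]//]; split=> //; exact: vle_trans le_uv.
have le_vu: vle v u by move: (vle_total u v); rewrite (negbTE nle_uv).
by apply/idP/andP => [le_wv|[]//]; split=> //; exact: vle_trans le_vu.
Qed.

(** Turns bounds on a minimum into bounds on each term. The neutral value [None] is the largest one,
    which settles the empty family. *)
Lemma vle_bigmin w n (F : 'I_n -> option G) :
  reflect (forall i, vle w (F i)) (vle w (\big[@vmin G/None]_(i < n) F i)).
Proof.
elim: n F => [|n IHn] F; first by rewrite big_ord0; case: w => [a|]; constructor; case.
rewrite big_ord_recl vle_vmin; apply: (iffP andP) => [[le0 /IHn leS] i|leF].
  by case: (unliftP ord0 i) => [j|] ->.
by split=> //; apply/IHn.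
Qed.

Lemma vle_anti u v : vle u v -> vle v u -> u = v.
Proof.
case: u v => [a|] [b|] //= le_ab le_ba.
by congr Some; apply: le_anti; rewrite le_ab.
Qed.

Lemma vmax_exists (I : finType) (P : pred I) (F : I -> option G) (i0 : I) :
  P i0 -> exists2 i, P i & forall j, P j -> vle (F j) (F i).
Proof.
move=> Pi0; pose ge u v := vle v u.
have ge_refl : reflexive ge by exact: vle_refl.
have ge_trans : transitive ge by move=> v u w uv vw; exact: vle_trans vw uv.
have ge_total : total ge by move=> u v; exact: vle_total.
by case: (extremumP F ge_refl ge_trans ge_total Pi0) => i Pi max_i; exists i.
Qed.

End ExtendedOrder.

(** * Finitely generated submodules and matrices *)

Section Spans.
Variables (K L : fieldType) (iota : {rmorphism K -> L}).

Lemma mem_span n (l : 'I_n -> L) i : span iota l (l i).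
Proof.
exists (fun j => (j == i)%:R) => //.
rewrite (bigD1 i) //= eqxx rmorph1 mul1r big1 ?addr0 // => j /negbTE ->.
by rewrite rmorph0 mul0r.
Qed.

Lemma span_matrix n (l : 'I_n -> L) m (e : 'I_m -> L) :
    (forall j, span iota l (e j)) ->
  exists A : 'M[K]_(m, n), forall j, e j = \sum_i iota (A j i) * l i.
Proof.
move=> el; have /choice[a ea] : forall j, exists a : 'I_n -> K, e j = \sum_i iota (a i) * l i.
  by move=> j; have [a _ <-] := el j; exists a.
by exists (\matrix_(j, i) a j i) => j; rewrite ea; apply: eq_bigr => i _; rewrite mxE.
Qed.

(** A left inverse of [A] writes the [l i] back as combinations of the [e j]. *)
Lemma row_full_span n (l : 'I_n -> L) m (e : 'I_m -> L) (A : 'M[K]_(m, n)) :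
  (forall j, e j = \sum_i iota (A j i) * l i) -> row_full A ->
  span iota e = span iota l.
Proof.
move=> eA /row_fullP[B BA].
have sum_e x : \sum_j iota (x j) * e j = \sum_i iota (\sum_j x j * A j i) * l i.
  under eq_bigr do rewrite eA mulr_sumr.
  rewrite exchange_big; apply: eq_bigr => i _; rewrite rmorph_sum mulr_suml.
  by apply: eq_bigr => j _; rewrite mulrA -rmorphM.
apply/seteqP; split=> _ [x _ <-].
  by rewrite sum_e; exists (fun i => \sum_j x j * A j i).
pose y := (\row_i x i) *m B; exists (y 0) => //; rewrite sum_e.
apply: eq_bigr => i _; congr (iota _ * _).
by transitivity ((y *m A) 0 i); [rewrite mxE|rewrite -mulmxA BA mulmx1 mxE].
Qed.

Lemma spanZ c n (l : 'I_n -> L) :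
  span iota (fun i => c * l i) = [set c * y | y in span iota l].
Proof.
apply/seteqP; split=> [_ [x _ <-]|_ [_ [x _ <-] <-]].
  exists (\sum_i iota (x i) * l i); first by exists x.
  by rewrite mulr_sumr; apply: eq_bigr => i _; rewrite mulrCA.
by exists x => //; rewrite mulr_sumr; apply: eq_bigr => i _; rewrite mulrCA.
Qed.

End Spans.

(** * Module valuations and separated families *)

Section ModuleValuation.
Variables (K L : fieldType) (iota : {rmorphism K -> L}).
Variables (G : porderZmodType) (G_lin : linearly_ordered_group G).
Variables (nu : L -> option G) (nu_val : module_valuation iota nu).

Lemma nu0 : nu 0 = None.
Proof. exact/(mval_eq_oo nu_val). Qed.

Lemma nu_neq0 y : y != 0 -> exists g, nu y = Some g.
Proof.
case Dg: (nu y) => [g|] => [_|]; first by exists g.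
by move/(mval_eq_oo nu_val): Dg => ->; rewrite eqxx.
Qed.

Lemma nu1 : nu 1 = Some 0.
Proof.
have [g nu1] := nu_neq0 (oner_neq0 L).
have := mval_scale nu_val 1 1; rewrite rmorph1 mulr1 nu1 => -[].
by move=> /eqP; rewrite -subr_eq0 opprD addrA subrr sub0r oppr_eq0 => /eqP ->.
Qed.

Lemma nuN y : nu (- y) = nu y.
Proof.
have nuN1 : nu (iota (-1)) = Some 0.
  have [|a nua] := @nu_neq0 (iota (-1)); first by rewrite fmorph_eq0 oppr_eq0 oner_eq0.
  have := mval_scale nu_val (-1) (iota (-1)).
  rewrite -rmorphM mulrNN mulr1 rmorph1 nu1 nua => -[aa0].
  (* The value [a] of -1 satisfies [a + a = 0]; adding [a] to either comparison of [a] with 0 yields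
     the opposite one. *)
  congr Some; apply: le_anti.
  case/orP: (G_lin.1 a 0) => a0; rewrite a0 ?andbT /=.
    by have := G_lin.2 _ _ a a0; rewrite -aa0 addr0.
  by have := G_lin.2 _ _ a a0; rewrite -aa0 addr0.
by rewrite -mulN1r -(rmorph1 iota) -rmorphN (mval_scale nu_val) nuN1 vadd0.
Qed.

Lemma vle_nuD w y z : vle w (nu y) -> vle w (nu z) -> vle w (nu (y + z)).
Proof.
move=> wy wz; apply: vle_trans (mval_add nu_val y z).
by rewrite vle_vmin // wy.
Qed.

Lemma vle_nu_sum w n (F : 'I_n -> L) :
  (forall i, vle w (nu (F i))) -> vle w (nu (\sum_(i < n) F i)).
Proof.
move=> wF; elim/big_ind: _ => // [|y z]; last exact: vle_nuD.
by rewrite nu0; case: (w).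
Qed.

(** By the ultrametric inequality a term of least value is bounded by the value of the sum; a
    nonzero sum has at least one term. *)
Lemma nu_sum_attained n (F : 'I_n -> L) :
  \sum_i F i != 0 -> exists i, vle (nu (F i)) (nu (\sum_i F i)).
Proof.
elim: n F => [|n IHn] F; first by rewrite big_ord0 eqxx.
rewrite big_ord_recl; set S := \sum_(i < n) _ => _.
have [->|/IHn[i le_i]] := eqVneq S 0.
  by exists ord0; rewrite addr0; exact: vle_refl.
have := mval_add nu_val (F ord0) S; rewrite /vmin; case: ifP => _ le_S.
  by exists ord0.
by exists (lift ord0 i); exact: vle_trans le_i le_S.
Qed.

Lemma vle_nuZ c y z :
  vle (nu y) (nu z) -> vle (nu (iota c * y)) (nu (iota c * z)).
Proof. by move=> yz; rewrite !(mval_scale nu_val); exact: vle_vadd. Qed.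

(** The ultrametric inequality already bounds the value of a sum below by the minimum, so only the
    upper bound by each term remains. *)
Lemma separatedP n (l : 'I_n -> L) :
  separated iota nu l <->
  (forall i, l i != 0) /\
  forall (x : 'I_n -> K) i,
    vle (nu (\sum_(i < n) iota (x i) * l i)) (nu (iota (x i) * l i)).
Proof.
split=> -[l0 sep]; split=> // x.
  by apply/vle_bigmin => //; rewrite -sep; exact: vle_refl.
apply: vle_anti; first exact/vle_bigmin.
by apply: vle_nu_sum; apply/vle_bigmin => //; exact: vle_refl.
Qed.

Lemma separated_lin_indep n (l : 'I_n -> L) :
  separated iota nu l -> lin_indep iota l.
Proof.
move=> /separatedP[l0 sep] x x0 i; have := sep x i; rewrite x0 nu0.
case Dg: (nu _) => [//|] _; move/(mval_eq_oo nu_val): Dg => /eqP.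
by rewrite mulf_eq0 (negbTE (l0 i)) orbF fmorph_eq0 => /eqP.
Qed.

Lemma separated_kernel n (l : 'I_n.+1 -> L) (f : 'I_n.+1 -> K) :
    separated iota nu l -> (exists i, f i != 0) ->
  exists2 l' : 'I_n -> L, separated iota nu l' &
    forall y : 'I_n.+1 -> K, \sum_(i < n.+1) y i * f i = 0 ->
      span iota l' (\sum_(i < n.+1) iota (y i) * l i).
Proof.
move=> sep_l [i0 fi0]; have /separatedP[l0 sep] := sep_l.
have [i fi max_i] := @vmax_exists _ G_lin _ (fun i => f i != 0)
  (fun i => nu (iota (f i)^-1 * l i)) i0 fi0.
(* The multiple of [l i] subtracted from [l j] has value at least that of [l j], so passing to [l']
   does not lower values. *)
have le_l j : vle (nu (l j)) (nu (iota (f j / f i) * l i)).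
  have [->|fj] := eqVneq (f j) 0; first by rewrite mul0r rmorph0 mul0r nu0; case: (nu _).
  have := vle_nuZ (f j) (max_i j fj); rewrite !mulrA -!rmorphM.
  by rewrite mulfV // rmorph1 mul1r.
pose l' j := l (lift i j) - iota (f (lift i j) / f i) * l i.
have sum_l' (x : 'I_n -> K) : \sum_j iota (x j) * l' j =
    - iota (\sum_j x j * f (lift i j) / f i) * l i
    + \sum_j iota (x j) * l (lift i j).
  rewrite rmorph_sum mulNr mulr_suml addrC -sumrB; apply: eq_bigr => j _.
  by rewrite mulrBr -[x j * _ / _]mulrA [iota (x j * _)]rmorphM mulrA.
(* Completing [x] by a coefficient [x0] at [i] turns a combination of [l'] into one of [l] with the
   same coefficients off [i]. *)
pose ext x0 (x : 'I_n -> K) k := if unlift i k is Some j then x j else x0.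
have sum_ext x0 (x : 'I_n -> K) : \sum_k iota (ext x0 x k) * l k =
    iota x0 * l i + \sum_j iota (x j) * l (lift i j).
  rewrite (bigD1_ord i) //= /ext unlift_none; congr (_ + _).
  by apply: eq_bigr => j _; rewrite liftK.
exists l'.
  apply/separatedP; split=> [j|x j].
    (* A vanishing [l' j] would be a relation between the [l k] with coefficient 1 at [lift i j]. *)
    apply/eqP => l'j0; pose x k := if k == j then 1 else 0 : K.
    have := separated_lin_indep sep_l (x := ext (- \sum_j x j * f (lift i j) / f i) x).
    rewrite sum_ext rmorphN -sum_l' (bigD1 j) //= l'j0 mulr0 add0r big1; last first.
      by move=> k /negbTE kj; rewrite /x kj rmorph0 mul0r.
    by move=> /(_ erefl (lift i j)) /eqP; rewrite /ext liftK /x eqxx oner_eq0.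
  have := sep (ext (- \sum_j x j * f (lift i j) / f i) x) (lift i j).
  rewrite sum_ext rmorphN -sum_l' /ext liftK => /vle_trans; apply.
  apply: vle_nuZ; apply: vle_nuD; first exact: vle_refl.
  by rewrite nuN.
(* The relation [yf] determines the coefficient of [y] at [i] from the others, and it is the one
   that [l'] produces. *)
move=> y; rewrite !(bigD1_ord i) //= => yf; exists (fun j => y (lift i j)) => //.
rewrite sum_l' -rmorphN -mulr_suml; congr (iota _ * _ + _).
by apply: (mulIf fi); rewrite mulNr divfK //; apply/eqP; rewrite eq_sym -addr_eq0 yf.
Qed.

(** The family [e] stays fixed while [l] loses one vector at a time, until both span the same
    space. *)
Lemma submodule_separated_basis n (l : 'I_n -> L) m (e : 'I_m -> L) :
    separated iota nu l -> (forall j, span iota l (e j)) ->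
  exists n' (l' : 'I_n' -> L), is_basis iota (span iota e) l' /\ separated iota nu l'.
Proof.
elim: n l => [|n IHn] l sep_l /span_matrix[A eA]; have [full|not_full] := boolP (row_full A).
- exists 0%N, l; split=> //; split; first exact: separated_lin_indep.
  exact: row_full_span eA full.
- by case/negP: not_full; rewrite /row_full eqn_leq rank_leq_col.
- exists n.+1, l; split=> //; split; first exact: separated_lin_indep.
  exact: row_full_span eA full.
(* The columns of [cokermx A] are linear forms vanishing on the rows of [A]. The rank of this matrix
   is the corank of [A], so some column is nonzero. *)
have [k [j fkj]] : exists k j, cokermx A k j != 0.
  apply: contrapT => noex; move/negP: not_full; apply.
  have C0 : cokermx A = 0.
    apply/matrixP => k j; rewrite [RHS]mxE; apply: contrapT => /eqP fkj.
    by apply: noex; exists k, j.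
  by have := mxrank_coker A; rewrite C0 mxrank0 /row_full => /esym/eqP;
     rewrite subn_eq0 eqn_leq rank_leq_col.
have [l' sep_l' span_l'] := separated_kernel (f := fun i => cokermx A i j) sep_l
  (ex_intro _ k fkj).
apply: (IHn l' sep_l') => i; rewrite eA; apply: span_l'.
by have /matrixP/(_ i j) := mulmx_coker A; rewrite !mxE.
Qed.

(** Dividing by the coefficient of [y] and using maximality, the value of a combination is at most
    that of its [y]-term, hence also at most that of the remaining part. *)
Lemma separated_cons n (l : 'I_n -> L) y :
    separated iota nu l -> y != 0 ->
    (forall w, span iota l w -> vle (nu (y - w)) (nu y)) ->
  separated iota nu (fun i => if unlift ord0 i is Some j then l j else y).
Proof.
move=> /separatedP[l0 sep] y0 max_y; apply/separatedP; split=> [i|x i].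
  by case: unliftP.
rewrite big_ord_recl unlift_none; under eq_bigr do rewrite liftK.
set w := \sum_(i < n) _; set x0 := x ord0.
have le_y : vle (nu (iota x0 * y + w)) (nu (iota x0 * y)).
  have [->|x00] := eqVneq x0 0; first by rewrite rmorph0 mul0r nu0; case: (nu _).
  have -> : iota x0 * y + w = iota x0 * (y - (- (iota x0)^-1 * w)).
    by rewrite mulNr opprK mulrDr mulVKf // fmorph_eq0.
  apply: vle_nuZ; apply: max_y; exists (fun i => - x0^-1 * x (lift ord0 i)) => //.
  by rewrite /w mulr_sumr; apply: eq_bigr => j _; rewrite rmorphM rmorphN fmorphV mulrA.
case: unliftP => [j|] -> //; rewrite -/x0.
apply: vle_trans (sep (fun j => x (lift ord0 j)) j).
(* Here [w] is recovered as the whole sum minus [iota x0 * y]. *)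
rewrite -/w -[in X in vle _ X](addKr (iota x0 * y) w).
by apply: vle_nuD; rewrite ?nuN //; exact: vle_refl.
Qed.

End ModuleValuation.

(** * Evaluation at [chi] and freeness of its powers *)

Section Polynomials.
Variables (K L : fieldType) (iota : {rmorphism K -> L}) (chi : L).

Definition evalp (p : {poly K}) : L := (map_poly iota p).[chi].

Lemma evalpB p q : evalp (p - q) = evalp p - evalp q.
Proof. by rewrite /evalp rmorphB hornerD hornerN. Qed.

Lemma evalpM p q : evalp (p * q) = evalp p * evalp q.
Proof. by rewrite /evalp rmorphM hornerM. Qed.

Lemma evalpC c : evalp c%:P = iota c.
Proof. by rewrite /evalp map_polyC hornerC. Qed.

Lemma evalpXn n : evalp 'X^n = chi ^+ n.
Proof. by rewrite /evalp map_polyXn hornerXn. Qed.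

Lemma evalp0 : evalp 0 = 0.
Proof. by rewrite -polyC0 evalpC rmorph0. Qed.

Lemma evalpZ c p : evalp (c *: p) = iota c * evalp p.
Proof. by rewrite -mul_polyC evalpM evalpC. Qed.

Lemma evalp_sum n (x : 'I_n -> K) (p : 'I_n -> {poly K}) :
  evalp (\sum_i x i *: p i) = \sum_i iota (x i) * evalp (p i).
Proof.
rewrite /evalp rmorph_sum horner_sum.
by apply: eq_bigr => i _; rewrite -evalpZ.
Qed.

Lemma polys_in_span n :
  polys_in iota chi (Some n) = span iota (fun i : 'I_n.+1 => chi ^+ i).
Proof.
apply/seteqP; split=> [_ [p size_p <-]|_ [x _ <-]].
  exists (fun i => p`_i) => //; rewrite -/(evalp p).
  have {2}-> : p = \sum_(i < n.+1) p`_i *: 'X^i.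
    rewrite -poly_def; apply/polyP => i; rewrite coef_poly; case: ltnP => // ni.
    by rewrite nth_default // (leq_trans size_p).
  by rewrite evalp_sum; apply: eq_bigr => i _; rewrite evalpXn.
exists (\poly_(i < n.+1) (if insub i is Some j then x j else 0)).
  exact: size_poly.
rewrite -/(evalp _) poly_def evalp_sum.
by apply: eq_bigr => i _; rewrite evalpXn valK.
Qed.

(** Linear independence of the powers of [chi] up to [d]: the common form of the algebraic case,
    with [d] below the degree, and the transcendental case. *)
Definition free_upto (d : option nat) : Prop :=
  forall p : {poly K}, (if d is Some k then (size p <= k.+1)%N else true) ->
    evalp p = 0 -> p = 0.

Lemma free_uptoS n d :
  free_upto d -> (if d is Some k then (n <= k)%N else true) -> free_upto (Some n).
Proof.
move=> free_d nd p size_p; apply: free_d.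
by case: d nd => // k nk; exact: leq_trans size_p _.
Qed.

Lemma transcendental_free d : ~ algebraicOver iota chi -> free_upto d.
Proof.
move=> tr p _ p0; apply: contrapT => /eqP pN0; apply: tr.
by exists p => //; apply/rootP.
Qed.

(** Modulo a nonzero [p] of degree at most [k] vanishing at [chi], the [m] basis elements would be
    values of polynomials with only [k] coefficients, hence dependent. *)
Lemma has_dim_free k m :
  has_dim iota (polys_in iota chi None) m -> (k < m)%N -> free_upto (Some k).
Proof.
move=> [l [indep_l span_l]] km p size_p p0; apply: contrapT => /eqP pN0.
have /choice[q ql] : forall i, exists q, evalp q = l i.
  move=> i; suff: polys_in iota chi None (l i) by case=> q _ <-; exists q.
  by rewrite span_l; exact: mem_span.
pose r i := q i %% p.
have rl i : evalp (r i) = l i.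
  by rewrite -ql [in RHS](divp_eq (q i) p) /evalp rmorphD hornerD -/(evalp (_ * _))
    evalpM p0 mulr0 add0r.
have size_r i : (size (r i) <= k)%N by rewrite -ltnS (leq_trans _ size_p) // ltn_modp.
pose A := \matrix_(i < m, j < k) (r i)`_j.
have : kermx A != 0.
  rewrite -mxrank_eq0 mxrank_ker subn_eq0 -ltnNge.
  exact: leq_ltn_trans (rank_leq_col A) km.
(* Each row of the left kernel of [A] is a relation between the [l i], so independence forces the
   kernel to be zero. *)
move=> /eqP; apply; apply/matrixP => h i; rewrite [RHS]mxE.
apply: (indep_l (fun i => kermx A h i)).
under eq_bigr do rewrite -rl.
rewrite -evalp_sum; set s := \sum_i _; suff -> : s = 0 by exact: evalp0.
apply/polyP => j; rewrite coef0 coef_sum.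
under eq_bigr do rewrite coefZ.
have [jk|kj] := ltnP j k; last first.
  by rewrite big1 // => i' _; rewrite [_`_j]nth_default ?mulr0 // (leq_trans (size_r i')).
have /matrixP/(_ h (Ordinal jk)) := mulmx_ker A; rewrite mxE [RHS]mxE => kerA.
by rewrite -[RHS]kerA; apply: eq_bigr => i' _; congr (_ * _); rewrite mxE.
Qed.

(** * Separated bases against maximal elements *)

Variables (G : porderZmodType) (G_lin : linearly_ordered_group G).
Variables (nu : L -> option G) (nu_val : module_valuation iota nu).

Lemma separated_basis_maximal n m (l : 'I_m -> L) :
    free_upto (Some n.+1) -> is_basis iota (polys_in iota chi (Some n.+1)) l ->
    separated iota nu l ->
  has_maximal (dist_values nu (chi ^+ n.+1) (polys_in iota chi (Some n))).
Proof.
move=> free_n [_ span_l] /(separatedP G_lin nu_val)[l0 sep].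
have /choice[p pl] : forall i, exists p : {poly K}, (size p <= n.+2)%N /\ evalp p = l i.
  move=> i; suff: polys_in iota chi (Some n.+1) (l i) by case=> q sq <-; exists q.
  by rewrite span_l; exact: mem_span.
pose f i := (p i)`_n.+1.
(* Freeness lifts the expansion of [evalp q] to an identity of polynomials, so that top coefficients
   can be compared. *)
have decomp (q : {poly K}) : (size q <= n.+2)%N ->
    exists2 x : 'I_m -> K, evalp q = \sum_i iota (x i) * l i &
      q`_n.+1 = \sum_i x i * f i.
  move=> sq; have : polys_in iota chi (Some n.+1) (evalp q) by exists q.
  rewrite span_l => -[x _ qx]; exists x => //.
  suff -> : q = \sum_i x i *: p i.
    by rewrite coef_sum; apply: eq_bigr => i _; rewrite coefZ.
  apply/eqP; rewrite -subr_eq0; apply/eqP; apply: free_n => /=.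
    rewrite (leq_trans (size_polyD _ _)) // geq_max sq size_polyN.
    apply: (leq_trans (size_sum _ _ _)); apply/bigmax_leqP => i _.
    exact: leq_trans (size_scale_leq _ _) (pl i).1.
  rewrite evalpB evalp_sum -qx.
  by under eq_bigr do rewrite -(pl _).2; rewrite subrr.
(* Since the [x i * f i] add up to 1, one of them has value at most 0; for this index, [x k * l k]
   has value at most that of [l k / f k]. *)
have affine (q : {poly K}) : (size q <= n.+2)%N -> q`_n.+1 = 1 ->
    exists2 k, f k != 0 & vle (nu (evalp q)) (nu (iota (f k)^-1 * l k)).
  move=> sq q1; have [x qx] := decomp q sq; rewrite q1 => x1.
  have sum1 : \sum_i iota (x i * f i) = 1 by rewrite -rmorph_sum -x1 rmorph1.
  have [k] : exists k, vle (nu (iota (x k * f k))) (nu (\sum_i iota (x i * f i))).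
    by apply: (nu_sum_attained nu_val); rewrite sum1 oner_eq0.
  rewrite sum1 => le_k; have fk : f k != 0.
    apply/eqP => fk; move: le_k.
    by rewrite fk mulr0 rmorph0 (nu0 nu_val) (nu1 nu_val).
  exists k => //; rewrite qx; apply: vle_trans (sep x k) _.
  have -> : iota (x k) * l k = iota (x k * f k) * (iota (f k)^-1 * l k).
    by rewrite mulrA -rmorphM mulfK.
  rewrite (mval_scale nu_val) -[X in vle _ X]vadd0 -(nu1 nu_val).
  by rewrite ![vadd _ (nu (_ * l k))]vaddC; exact: vle_vadd.
have [k0 fk0 _] : exists2 k, f k != 0 & vle (nu (evalp 'X^(n.+1))) (nu (iota (f k)^-1 * l k)).
  by apply: affine; rewrite ?size_polyXn // coefXn eqxx.
have [k fk max_k] := @vmax_exists _ G_lin _ (fun k => f k != 0)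
  (fun k => nu (iota (f k)^-1 * l k)) k0 fk0.
have [|g nu_g] := @nu_neq0 _ _ _ _ _ nu_val (iota (f k)^-1 * l k).
  by rewrite mulf_neq0 // fmorph_eq0 invr_eq0.
exists g.
  (* Normalising [p k] by [f k] cancels the term of degree [n.+1], and the difference from
     [chi ^+ n.+1] is exactly [l k / f k]. *)
  exists (evalp ('X^(n.+1) - (f k)^-1 *: p k)).
    exists ('X^(n.+1) - (f k)^-1 *: p k) => //=.
    apply/leq_sizeP => j; rewrite leq_eqVlt => /predU1P[<-|lt_j].
      by rewrite coefB coefXn eqxx coefZ mulVf // subrr.
    rewrite coefB coefXn gtn_eqF // coefZ [_`_j]nth_default ?mulr0 ?subrr //.
    exact: leq_trans (pl k).1 _.
  by rewrite evalpB evalpXn evalpZ (pl k).2 opprB addrC subrK.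
move=> h [_ [q /= sq <-] nu_h]; rewrite -/(evalp q) -evalpXn -evalpB in nu_h.
have [||k' fk' le_k'] := affine ('X^(n.+1) - q).
- rewrite (leq_trans (size_polyD _ _)) // geq_max size_polyXn size_polyN leqnn.
  exact: leq_trans sq _.
- by rewrite coefB coefXn eqxx [_`__]nth_default ?subr0.
have := vle_trans le_k' (max_k k' fk'); rewrite nu_h nu_g /= => le_hg.
by apply/negP => /(le_lt_trans le_hg); rewrite ltxx.
Qed.

Lemma maximal_separated_basis n :
    free_upto (Some n) ->
    (forall k, (1 <= k <= n)%N ->
      has_maximal (dist_values nu (chi ^+ k) (polys_in iota chi (Some k.-1)))) ->
  exists2 l : 'I_n.+1 -> L, separated iota nu l &
    span iota l = polys_in iota chi (Some n).
Proof.
elim: n => [|n IHn] free_n max_n.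
  exists (fun=> 1); last first.
    by rewrite polys_in_span; congr span; apply: funext => i; rewrite ord1.
  apply/(separatedP G_lin nu_val); split=> [i|x i]; first exact: oner_neq0.
  by rewrite big_ord1 (ord1 i); exact: vle_refl.
have [||l sep_l span_l] := IHn.
- by apply: free_uptoS free_n _.
- by move=> k /andP[k1 kn]; apply: max_n; rewrite k1 leqW.
have [g [w w_n nu_g] max_g] := max_n n.+1 (leqnn _).
set y := chi ^+ n.+1 - w in nu_g.
have y0 : y != 0 by apply/eqP => y0; move: nu_g; rewrite y0 (nu0 nu_val).
exists (fun i => if unlift ord0 i is Some j then l j else y).
  apply: separated_cons => // v; rewrite span_l nu_g => v_n.
  case: w_n v_n @y nu_g y0 => p sp <- [q sq <-] y _ _.
  (* Subtracting an element of the previous span from [y] stays within the differences over which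
     [g] is maximal. *)
  have yE : y - (map_poly iota q).[chi] = chi ^+ n.+1 - evalp (p + q).
    by rewrite /y /evalp rmorphD hornerD opprD addrA.
  have spq : (size (p + q)%R <= n.+1)%N.
    by rewrite (leq_trans (size_polyD _ _)) // geq_max sp.
  (* [dist_values] discards infinity, so maximality of [g] applies only to a nonzero difference. *)
  have : chi ^+ n.+1 - evalp (p + q) != 0.
    rewrite -evalpXn -evalpB; apply/eqP => /free_n r0.
    have : ('X^(n.+1) - (p + q))`_n.+1 = 1 by rewrite coefB coefXn eqxx nth_default // subr0.
    rewrite r0; first by rewrite coef0 => /esym/eqP; rewrite oner_eq0.
    rewrite /= (leq_trans (size_polyD _ _)) // geq_max size_polyXn size_polyN leqnn.
    exact: leqW.
  move=> /(nu_neq0 nu_val)[h nu_h]; rewrite yE nu_h /=.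
  have := max_g h; case/orP: (G_lin.1 h g) => // le_gh.
  have gh : ~~ (g < h) by apply: max_g; exists (evalp (p + q)) => //; exists (p + q).
  by move: gh; rewrite lt_neqAle le_gh andbT negbK => /eqP ->; rewrite lexx.
move: w_n; rewrite -span_l => -[a _ wE].
apply/seteqP; split=> [_ [x _ <-]|].
  rewrite big_ord_recl unlift_none; under eq_bigr do rewrite liftK.
  have [p sp pE] : polys_in iota chi (Some n) w by rewrite -span_l; exists a.
  have [q sq qE] : polys_in iota chi (Some n) (\sum_i iota (x (lift ord0 i)) * l i).
    by rewrite -span_l; exists (fun i => x (lift ord0 i)).
  exists (x ord0 *: ('X^(n.+1) - p) + q); last first.
    by rewrite rmorphD hornerD qE -/(evalp _) evalpZ evalpB evalpXn /evalp pE.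
  rewrite /= (leq_trans (size_polyD _ _)) // geq_max; apply/andP; split; last exact: leqW.
  apply: leq_trans (size_scale_leq _ _) _.
  rewrite (leq_trans (size_polyD _ _)) // geq_max size_polyXn size_polyN leqnn.
  exact: leqW.
move=> _ [p sp <-]; rewrite -/(evalp p).
have : polys_in iota chi (Some n) (evalp (p - p`_n.+1 *: 'X^(n.+1))).
  exists (p - p`_n.+1 *: 'X^(n.+1)) => //=.
  apply/leq_sizeP => j; rewrite leq_eqVlt coefB coefZ coefXn => /predU1P[<-|lt_j].
    by rewrite eqxx mulr1 subrr.
  by rewrite gtn_eqF // mulr0 subr0 nth_default // (leq_trans sp).
rewrite -span_l evalpB evalpZ evalpXn => -[b _ bE].
(* As [chi ^+ n.+1] is [y + w], the top term of [p] contributes its coefficient at [y] and that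
   multiple of the coordinates [a] of [w]. *)
exists (fun i => if unlift ord0 i is Some j then b j + p`_n.+1 * a j else p`_n.+1) => //.
rewrite big_ord_recl unlift_none; under eq_bigr do rewrite liftK rmorphD mulrDl rmorphM -mulrA.
by rewrite big_split -mulr_sumr /= bE wE /y mulrBr addrC -addrA addKr addrC subrK.
Qed.

Lemma polys_in_vs_defectlessP d :
    d <> Some 0%N -> free_upto d ->
  vs_defectless iota nu (polys_in iota chi d) <->
  (forall n : nat, (1 <= n)%N -> (if d is Some k then (n <= k)%N else true) ->
    has_maximal (dist_values nu (chi ^+ n) (polys_in iota chi (Some n.-1)))).
Proof.
move=> d0 free_d; split=> [defectless [//|n] _ nd|max_d M Md [m [e Me]]].
  have [||m [l [basis_l sep_l]]] := defectless (polys_in iota chi (Some n.+1)).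
  - move=> _ [p sp <-]; exists p => //; case: d nd {d0 free_d defectless} => // k nk.
    exact: leq_trans sp _.
  - by rewrite polys_in_span; exists n.+2, (fun i => chi ^+ i).
  by apply: separated_basis_maximal basis_l sep_l; exact: free_uptoS free_d nd.
have Me_ j : M (e j) by rewrite Me; exact: mem_span.
(* Even for infinite [d], finitely many generators have bounded degree and lie in a finite stage. *)
have [n nd en] : exists2 n, is_true (if d is Some k then (n <= k)%N else true) &
    forall j, polys_in iota chi (Some n) (e j).
  case: d Md {d0 free_d max_d} => [k|] Md.
    by exists k => // j; exact: Md.
  have /choice[p pe] : forall j, exists p, evalp p = e j.
    by move=> j; have [p _ <-] := Md _ (Me_ j); exists p.
  exists (\max_j size (p j)) => // j; exists (p j); last exact: pe.
  by apply: leqW; exact: (leq_bigmax j).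
have [||l sep_l span_l] := @maximal_separated_basis n.
- exact: free_uptoS free_d nd.
- move=> k /andP[k1 kn]; apply: max_d => //.
  by case: (d) nd => // k' /(leq_trans kn).
rewrite Me; apply: (submodule_separated_basis G_lin nu_val sep_l) => j.
by rewrite span_l.
Qed.

Lemma fractions_in_vs_defectlessP :
    multiplicative_on nu (fractions_in iota chi) ->
  vs_defectless iota nu (fractions_in iota chi) <->
  vs_defectless iota nu (polys_in iota chi None).
Proof.
move=> nuM; have polys_fractions y : polys_in iota chi None y -> fractions_in iota chi y.
  move=> [p _ <-]; exists (p, 1); rewrite /= rmorph1 hornerC ?divr1 //.
  exact: oner_neq0.
split=> [defectless M Mp|defectless M MF [m [e Me]]].
  by apply: defectless => y /Mp /polys_fractions.
have Me_ j : M (e j) by rewrite Me; exact: mem_span.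
have /choice[r re] : forall j, exists r : {poly K} * {poly K},
    evalp r.2 != 0 /\ e j = evalp r.1 / evalp r.2.
  by move=> j; have [r r0 ->] := MF _ (Me_ j); exists r.
pose q := \prod_j (r j).2.
have evalq : evalp q = \prod_j evalp (r j).2.
  by rewrite /q; elim/big_rec2: _ => [|j y s _ <-]; rewrite ?evalpM // -polyC1 evalpC rmorph1.
have q0 : evalp q != 0.
  by rewrite evalq; apply/prodf_neq0 => j _; case: (re j).
pose e' j := evalp q * e j.
have [||n [l [[indep_l span_l] sep_l]]] := defectless (span iota e').
- move=> _ [x _ <-].
  exists (\sum_j x j *: ((\prod_(i | i != j) (r i).2) * (r j).1)) => //.
  rewrite -/(evalp _) evalp_sum; apply: eq_bigr => j _; congr (_ * _).
  have [rj0 ej] := re j; rewrite evalpM /e' ej.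
  have -> : evalp q = evalp (r j).2 * evalp (\prod_(i | i != j) (r i).2).
    by rewrite -evalpM /q (bigD1 j).
  by rewrite [RHS]mulrC mulrA divfK // mulrC.
- by exists m, e'.
have spanM : span iota (fun i => (evalp q)^-1 * l i) = M.
  rewrite spanZ -span_l spanZ Me; apply/seteqP; split=> [_ [_ [y ye <-] <-]|y ye].
    by rewrite mulKf.
  by exists (evalp q * y); [exists y|rewrite mulKf].
have /separatedP[//|//|l0 sep] := sep_l.
(* The factor [evalp q] need not lie in [K]; multiplicativity on the fractions is what allows its
   value to be cancelled. *)
have nuMq y z : M y -> M z -> vle (nu (evalp q * y)) (nu (evalp q * z)) -> vle (nu y) (nu z).
  have Fq : fractions_in iota chi (evalp q) by apply: polys_fractions; exists q.
  move=> My Mz; rewrite !nuM //; try exact: MF.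
  have [g ->] := nu_neq0 nu_val q0.
  by case: (nu y) (nu z) => [a|] [b|] //= /(G_lin.2 _ _ (- g)); rewrite !addKr.
have sum_q x : evalp q * (\sum_i iota (x i) * ((evalp q)^-1 * l i)) =
    \sum_i iota (x i) * l i.
  by rewrite mulr_sumr; apply: eq_bigr => i _; rewrite mulrCA mulVKf.
exists n, (fun i => (evalp q)^-1 * l i); split.
  split; last by [].
  by move=> x x0; apply: indep_l; rewrite -sum_q x0 mulr0.
apply/(separatedP G_lin nu_val); split=> [i|x i].
  by rewrite mulf_neq0 // invr_eq0.
apply: nuMq; last 1 first.
- by rewrite sum_q mulrCA mulVKf.
- by rewrite -spanM; exists x.
rewrite -spanM; exists (fun j => if j == i then x j else 0) => //.
rewrite (bigD1 i) //= eqxx big1 ?addr0 // => j /negbTE ->.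
by rewrite rmorph0 mul0r.
Qed.

End Polynomials.

(** * The two equivalences *)

Theorem proposition1p15 (K L : fieldType) (iota : {rmorphism K -> L})
    (G : porderZmodType) (G_lin : linearly_ordered_group G)
    (nu : L -> option G)
    (nu_val : module_valuation iota nu)
    (nu_rank : finite_rank (value_group iota nu))
    (chi : L) :
  (forall d : option nat,
     d <> Some 0%N ->
     (algebraicOver iota chi ->
        exists k m : nat,
          [/\ d = Some k, has_dim iota (polys_in iota chi None) m
            & (k < m)%N]) ->
     vs_defectless iota nu (polys_in iota chi d) <->
     (forall n : nat, (1 <= n)%N -> (if d is Some k then (n <= k)%N else true) ->
        has_maximal
          (dist_values nu (chi ^+ n) (polys_in iota chi (Some n.-1)))))
  /\
  (~ algebraicOver iota chi ->
   multiplicative_on nu (fractions_in iota chi) ->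
   vs_defectless iota nu (fractions_in iota chi) <->
   (forall n : nat, n <> 0%N ->
      has_maximal
        (dist_values nu (chi ^+ n) (polys_in iota chi (Some n.-1))))).
Proof.
have free_of_transc d := @transcendental_free _ _ iota chi d.
split=> [d d0 alg_d|tr nuM].
  apply: polys_in_vs_defectlessP => //.
  (* Either case yields freeness up to [d]: by the dimension bound if [chi] is algebraic, at once if
     it is transcendental. *)
  have [/alg_d[k [m [-> dim_m km]]]|/free_of_transc //] := EM (algebraicOver iota chi).
  exact: has_dim_free dim_m km.
rewrite fractions_in_vs_defectlessP // polys_in_vs_defectlessP //; last exact: free_of_transc.
split=> max_n n; first by case: n => // n _; exact: max_n.
by move=> n1 _; apply: max_n; case: n n1.
Qed.
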